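(* Let $L$ be a finite-dimensional nilpotent non-abelian Lie algebra of nilpotency class $c$. Then \[\dim (L\wedge L)+\dim \mathrm{Im}\,\gamma_L \leq \dim (L\wedge L)+\sum_{i=2}^c \dim \ker \alpha_i=\dim (L/L^2\wedge L/L^2)+\sum_{i=2}^c \dim (L^i/L^{i+1}\otimes_{mod} L/L^2).\]
   Context: Lie algebras are over a fixed field. $L^1=L$, $L^{i+1}=[L^i,L]$ is the lower central series (so $L^2=[L,L]$), and $L^{(ab)}=L/L^2$. The symbol $\otimes_{mod}$ denotes the usual tensor product of vector spaces (regarded as an abelian Lie algebra). For ideals $M,N$ of $L$, the (non-abelian) tensor product $M\otimes N$ is the Lie algebra generated by symbols $m\otimes n$ ($m\in M$, $n\in N$), subject to: bilinearity in $m,n$; $[m,m']\otimes n=m\otimes[m',n]-m'\otimes[m,n]$; $m\otimes[n,n']=[n',m]\otimes n-[n,m]\otimes n'$; $[m\otimes n,m'\otimes n']=-[n,m]\otimes[m',n']$. The exterior product $M\wedge N$ is the quotient of $M\otimes N$ by the ideal generated by all $x\otimes x$ with $x\in M\cap N$; the image of $m\otimes n$ is written $m\wedge n$. For $i\ge 2$, $\alpha_i:L^i\wedge L\to L^{i-1}\wedge L$ is the natural homomorphism $x\wedge z\mapsto x\wedge z$. $\gamma_L:L^{(ab)}\otimes_{mod}L^{(ab)}\otimes_{mod}L^{(ab)}\to L^2/L^3\otimes_{mod}L/L^2$ is the linear map given by $(x+L^2)\otimes(y+L^2)\otimes(z+L^2)\mapsto ([x,y]+L^3)\otimes(z+L^2)+([z,x]+L^3)\otimes(y+L^2)+([y,z]+L^3)\otimes(x+L^2)$.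 *)

(* Defs.v *)
From HB Require Import structures.
From mathcomp Require Import all_boot all_order all_algebra.
From mathcomp Require Import boolp.

Set Implicit Arguments.
Unset Strict Implicit.
Unset Printing Implicit Defensive.

Import GRing.Theory.
Local Open Scope ring_scope.
Local Open Scope quotient_scope.

Reserved Notation "⟦ x , y ⟧" (at level 0, format "⟦ x ,  y ⟧").

HB.mixin Record Lmodule_isLie (F : fieldType) L of GRing.Lmodule F L := {
  lieb : L -> L -> L;
  liebDl : forall x y z, lieb (x + y) z = lieb x z + lieb y z;
  liebDr : forall x y z, lieb x (y + z) = lieb x y + lieb x z;
  liebZl : forall a x y, lieb (a *: x) y = a *: lieb x y;
  liebZr : forall a x y, lieb x (a *: y) = a *: lieb x y;
  liebxx : forall x, lieb x x = 0;
  lieb_jacobi : forall x y z,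
    lieb x (lieb y z) + lieb y (lieb z x) + lieb z (lieb x y) = 0 }.

#[short(type="lieAlgType")]
HB.structure Definition LieAlg (F : fieldType) :=
  { L of Lmodule_isLie F L & GRing.Lmodule F L }.

#[short(type="finLieAlgType")]
HB.structure Definition FinLieAlg (F : fieldType) :=
  { L of LieAlg F L & Vector F L }.

Notation "⟦ x , y ⟧" := (lieb x y) : ring_scope.

Section LieTheory.
Variables (F : fieldType) (L : lieAlgType F).
Implicit Types x y z : L.

Lemma lieb0l x : ⟦0, x⟧ = 0 :> L.
Proof. by rewrite -[in LHS](scale0r (0 : L)) liebZl scale0r. Qed.

Lemma lieb0r x : ⟦x, 0⟧ = 0 :> L.
Proof. by rewrite -[in LHS](scale0r (0 : L)) liebZr scale0r. Qed.

Lemma liebNl x y : ⟦- x, y⟧ = - ⟦x, y⟧.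
Proof. by rewrite -scaleN1r liebZl scaleN1r. Qed.

Lemma liebNr x y : ⟦x, - y⟧ = - ⟦x, y⟧.
Proof. by rewrite -scaleN1r liebZr scaleN1r. Qed.

Lemma liebBl x y z : ⟦x - y, z⟧ = ⟦x, z⟧ - ⟦y, z⟧.
Proof. by rewrite liebDl liebNl. Qed.

Lemma liebBr x y z : ⟦x, y - z⟧ = ⟦x, y⟧ - ⟦x, z⟧.
Proof. by rewrite liebDr liebNr. Qed.

Lemma liebC x y : ⟦x, y⟧ = - ⟦y, x⟧.
Proof.
apply/eqP; rewrite -addr_eq0; apply/eqP.
by have := liebxx (x + y); rewrite liebDl !liebDr !liebxx add0r addr0.
Qed.

Lemma lieb_suml I r (P : pred I) (f : I -> L) y :
  ⟦\sum_(i <- r | P i) f i, y⟧ = \sum_(i <- r | P i) ⟦f i, y⟧.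
Proof.
by apply: (big_morph (lieb^~ y)) => [u v|]; rewrite ?liebDl ?lieb0l.
Qed.

Lemma lieb_sumr I r (P : pred I) (f : I -> L) x :
  ⟦x, \sum_(i <- r | P i) f i⟧ = \sum_(i <- r | P i) ⟦x, f i⟧.
Proof.
by apply: (big_morph (lieb x)) => [u v|]; rewrite ?liebDr ?lieb0r.
Qed.

Definition lie_abelian : Prop := forall x y, ⟦x, y⟧ = 0.

End LieTheory.

Arguments lie_abelian {F} L.

Section FiniteDimension.
Variable F : fieldType.

Lemma vspace_of_pred (V : vectType F) (P : V -> Prop) :
    P 0 -> (forall x y, P x -> P y -> P (x + y)) ->
    (forall a x, P x -> P (a *: x)) ->
  {U : {vspace V} | forall x, x \in U <-> P x}.
Proof.
move=> P0 PD PZ; apply: cid.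
pose Q n := `[< exists2 U : {vspace V}, \dim U = n & forall x, x \in U -> P x >].
have exQ : exists n, Q n.
  exists 0%N; apply/asboolP; exists 0%VS; first exact: dimv0.
  by move=> x /[!memv0] /eqP ->.
have ubQ n : Q n -> (n <= \dim {:V})%N.
  by case/asboolP=> U <- _; apply/dimvS/subvf.
case: (ex_maxnP exQ ubQ) => n /asboolP[U dimU UP] maxn; exists U => x; split.
  exact: UP.
move=> Px; have UxP y : y \in (U + <[x]>)%VS -> P y.
  by case/memv_addP=> u /UP Pu [v /vlineP[k ->] ->]; apply: PD => //; apply: PZ.
have /maxn : Q (\dim (U + <[x]>)) by apply/asboolP; exists (U + <[x]>)%VS.
rewrite -dimU => le; have /eqP -> : U == (U + <[x]>)%VS.
  by rewrite eqEdim addvSl.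
by apply: (subvP (addvSr _ _)); exact: memv_line.
Qed.

Lemma findim_surj (U : vectType F) (V : lmodType F) (g : {linear U -> V}) :
  (forall v, exists u, g u = v) -> {n : nat & Vector.axiom n V}.
Proof.
move=> surj.
have [K KE] : {K : {vspace U} | forall x, x \in K <-> g x = 0}.
  apply: vspace_of_pred => [|x y gx gy|a x gx]; first exact: linear0.
    by rewrite linearD gx gy addr0.
  by rewrite linearZ /= gx scaler0.
have surjC v : exists u : subvs_of K^C, g (vsval u) = v.
  have [u <-] := surj v.
  have : u \in (K + K^C)%VS by rewrite addv_complf memvf.
  case/memv_addP=> k /KE gk [w Kw ->]; exists (Subvs Kw).
  by rewrite linearD gk add0r.
have injC : injective (fun u : subvs_of K^C => g (vsval u)).
  move=> u w; rewrite -[g (vsval w)]addr0 => /eqP; rewrite addrC -subr_eq.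
  rewrite -linearB => /eqP /KE uwK; apply/eqP; rewrite -subr_eq0.
  apply/eqP/subvs_inj; apply/eqP; rewrite linear0 linearB -memv0.
  rewrite -(capv_compl K).
  by rewrite memv_cap uwK rpredB ?subvsP.
pose h v := projT1 (cid (surjC v)).
have hK v : g (vsval (h v)) = v by rewrite /h; case: cid.
have hlin : linear h.
  by move=> a x y; apply: injC; rewrite hK !linearP /= !hK.
pose e := vbasis {:subvs_of K^C}.
have eb : basis_of fullv e := vbasisP _.
exists (\dim {:subvs_of K^C}); exists (fun v => passmx.rVof e (h v)).
  by move=> a x y /=; rewrite hlin passmx.rVof_linear.
exists (fun r => g (vsval (passmx.vecof e r))) => x; first by rewrite passmx.rVofK.
by apply: (can_inj (passmx.vecofK eb)); rewrite passmx.rVofK //; apply: injC; rewrite hK.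
Qed.

End FiniteDimension.

Section Presentation.
Variables (F : fieldType) (X : Type).

Inductive lie_term : Type :=
| TGen of X
| TZero
| TAdd of lie_term & lie_term
| TScale of F & lie_term
| TBr of lie_term & lie_term.

Definition TOpp t := TScale (-1) t.

HB.instance Definition _ := gen_eqMixin lie_term.
HB.instance Definition _ := gen_choiceMixin lie_term.

Variable R : lie_term -> lie_term -> Prop.

(* the least congruence containing R whose quotient is a Lie algebra over F *)
Inductive lie_cong : lie_term -> lie_term -> Prop :=
| Cong_rel s t : R s t -> lie_cong s t
| Cong_refl t : lie_cong t t
| Cong_sym s t : lie_cong s t -> lie_cong t s
| Cong_trans s t u : lie_cong s t -> lie_cong t u -> lie_cong s u
| Cong_add s s' t t' :
    lie_cong s s' -> lie_cong t t' -> lie_cong (TAdd s t) (TAdd s' t')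
| Cong_scale a t t' : lie_cong t t' -> lie_cong (TScale a t) (TScale a t')
| Cong_br s s' t t' :
    lie_cong s s' -> lie_cong t t' -> lie_cong (TBr s t) (TBr s' t')
| Cong_addA s t u : lie_cong (TAdd s (TAdd t u)) (TAdd (TAdd s t) u)
| Cong_addC s t : lie_cong (TAdd s t) (TAdd t s)
| Cong_add0 t : lie_cong (TAdd TZero t) t
| Cong_addN t : lie_cong (TAdd (TOpp t) t) TZero
| Cong_scaleA a b t : lie_cong (TScale a (TScale b t)) (TScale (a * b) t)
| Cong_scale1 t : lie_cong (TScale 1 t) t
| Cong_scaleDr a s t :
    lie_cong (TScale a (TAdd s t)) (TAdd (TScale a s) (TScale a t))
| Cong_scaleDl a b t :
    lie_cong (TScale (a + b) t) (TAdd (TScale a t) (TScale b t))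
| Cong_brDl s t u : lie_cong (TBr (TAdd s t) u) (TAdd (TBr s u) (TBr t u))
| Cong_brDr s t u : lie_cong (TBr s (TAdd t u)) (TAdd (TBr s t) (TBr s u))
| Cong_brZl a s t : lie_cong (TBr (TScale a s) t) (TScale a (TBr s t))
| Cong_brZr a s t : lie_cong (TBr s (TScale a t)) (TScale a (TBr s t))
| Cong_brxx t : lie_cong (TBr t t) TZero
| Cong_jacobi s t u :
    lie_cong (TAdd (TAdd (TBr s (TBr t u)) (TBr t (TBr u s))) (TBr u (TBr s t)))
             TZero.

Definition lie_congb s t := `[< lie_cong s t >].

Lemma lie_congb_refl : reflexive lie_congb.
Proof. by move=> t; apply/asboolP/Cong_refl. Qed.

Lemma lie_congb_sym : symmetric lie_congb.
Proof. by move=> s t; apply/asboolP/asboolP; apply: Cong_sym. Qed.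

Lemma lie_congb_trans : transitive lie_congb.
Proof.
by move=> t s u /asboolP st /asboolP tu; apply/asboolP; apply: Cong_trans tu.
Qed.

Canonical lie_cong_equiv :=
  EquivRel lie_congb lie_congb_refl lie_congb_sym lie_congb_trans.

Definition pres := {eq_quot lie_congb}.

HB.instance Definition _ := Choice.on pres.

Definition pres_pi (t : lie_term) : pres := \pi_{eq_quot lie_congb} t.

Lemma pres_eqP s t : pres_pi s = pres_pi t <-> lie_cong s t.
Proof.
split=> [/eqmodP/asboolP //|st].
by apply/eqmodP/asboolP.
Qed.

Definition pres_repr (q : pres) : lie_term := repr (q : {eq_quot lie_congb}).

Lemma pres_reprK : cancel pres_repr pres_pi.
Proof. by move=> q; exact: reprK. Qed.

Lemma repr_presP t : lie_cong (pres_repr (pres_pi t)) t.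
Proof. by apply/pres_eqP; rewrite pres_reprK. Qed.

Lemma presW (P : pres -> Prop) : (forall t, P (pres_pi t)) -> forall q, P q.
Proof. by move=> Pt q; rewrite -(pres_reprK q). Qed.

Definition pres_add p q := pres_pi (TAdd (pres_repr p) (pres_repr q)).
Definition pres_opp p := pres_pi (TOpp (pres_repr p)).
Definition pres_scale a p := pres_pi (TScale a (pres_repr p)).
Definition pres_br p q := pres_pi (TBr (pres_repr p) (pres_repr q)).

Lemma pres_addE s t : pres_add (pres_pi s) (pres_pi t) = pres_pi (TAdd s t).
Proof. by apply/pres_eqP/Cong_add; apply: repr_presP. Qed.

Lemma pres_oppE t : pres_opp (pres_pi t) = pres_pi (TOpp t).
Proof. by apply/pres_eqP/Cong_scale; apply: repr_presP. Qed.

Lemma pres_scaleE a t : pres_scale a (pres_pi t) = pres_pi (TScale a t).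
Proof. by apply/pres_eqP/Cong_scale; apply: repr_presP. Qed.

Lemma pres_brE s t : pres_br (pres_pi s) (pres_pi t) = pres_pi (TBr s t).
Proof. by apply/pres_eqP/Cong_br; apply: repr_presP. Qed.

Lemma pres_addA : associative pres_add.
Proof.
elim/presW=> s; elim/presW=> t; elim/presW=> u.
by rewrite !pres_addE; apply/pres_eqP/Cong_addA.
Qed.

Lemma pres_addC : commutative pres_add.
Proof.
elim/presW=> s; elim/presW=> t.
by rewrite !pres_addE; apply/pres_eqP/Cong_addC.
Qed.

Lemma pres_add0 : left_id (pres_pi TZero) pres_add.
Proof. by elim/presW=> t; rewrite pres_addE; apply/pres_eqP/Cong_add0. Qed.

Lemma pres_addN : left_inverse (pres_pi TZero) pres_opp pres_add.
Proof.
by elim/presW=> t; rewrite pres_oppE pres_addE; apply/pres_eqP/Cong_addN.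
Qed.

HB.instance Definition _ :=
  GRing.isZmodule.Build pres pres_addA pres_addC pres_add0 pres_addN.

Lemma pres_scaleA a b p : pres_scale a (pres_scale b p) = pres_scale (a * b) p.
Proof.
by elim/presW: p => t; rewrite !pres_scaleE; apply/pres_eqP/Cong_scaleA.
Qed.

Lemma pres_scale1 : left_id 1 pres_scale.
Proof. by elim/presW=> t; rewrite pres_scaleE; apply/pres_eqP/Cong_scale1. Qed.

Lemma pres_scaleDr : right_distributive pres_scale +%R.
Proof.
move=> a; elim/presW=> s; elim/presW=> t.
have -> : pres_pi s + pres_pi t = pres_pi (TAdd s t) by exact: pres_addE.
by rewrite !pres_scaleE [RHS]pres_addE; apply/pres_eqP/Cong_scaleDr.
Qed.

Lemma pres_scaleDl p : {morph pres_scale^~ p : a b / a + b}.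
Proof.
move=> a b; elim/presW: p => t; rewrite !pres_scaleE.
by rewrite [RHS]pres_addE; apply/pres_eqP/Cong_scaleDl.
Qed.

HB.instance Definition _ := GRing.Zmodule_isLmodule.Build F pres
  pres_scaleA pres_scale1 pres_scaleDr pres_scaleDl.

Lemma pres_piD s t : pres_pi (TAdd s t) = pres_pi s + pres_pi t.
Proof. by rewrite -pres_addE. Qed.

Lemma pres_piZ a t : pres_pi (TScale a t) = a *: pres_pi t.
Proof. by rewrite -pres_scaleE. Qed.

Lemma pres_pi0 : pres_pi TZero = 0. Proof. by []. Qed.

Lemma pres_piN t : pres_pi (TOpp t) = - pres_pi t.
Proof. by rewrite -pres_oppE. Qed.

Lemma pres_brDl p q r : pres_br (p + q) r = pres_br p r + pres_br q r.
Proof.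
elim/presW: p => s; elim/presW: q => t; elim/presW: r => u.
by rewrite -pres_piD !pres_brE -pres_piD; apply/pres_eqP/Cong_brDl.
Qed.

Lemma pres_brDr p q r : pres_br p (q + r) = pres_br p q + pres_br p r.
Proof.
elim/presW: p => s; elim/presW: q => t; elim/presW: r => u.
by rewrite -pres_piD !pres_brE -pres_piD; apply/pres_eqP/Cong_brDr.
Qed.

Lemma pres_brZl a p q : pres_br (a *: p) q = a *: pres_br p q.
Proof.
elim/presW: p => s; elim/presW: q => t.
by rewrite -pres_piZ !pres_brE -pres_piZ; apply/pres_eqP/Cong_brZl.
Qed.

Lemma pres_brZr a p q : pres_br p (a *: q) = a *: pres_br p q.
Proof.
elim/presW: p => s; elim/presW: q => t.
by rewrite -pres_piZ !pres_brE -pres_piZ; apply/pres_eqP/Cong_brZr.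
Qed.

Lemma pres_brxx p : pres_br p p = 0.
Proof.
by elim/presW: p => t; rewrite pres_brE -pres_pi0; apply/pres_eqP/Cong_brxx.
Qed.

Lemma pres_jacobi p q r :
  pres_br p (pres_br q r) + pres_br q (pres_br r p) + pres_br r (pres_br p q)
  = 0.
Proof.
elim/presW: p => s; elim/presW: q => t; elim/presW: r => u.
rewrite !pres_brE -!pres_piD -pres_pi0.
exact/pres_eqP/Cong_jacobi.
Qed.

HB.instance Definition _ := Lmodule_isLie.Build F pres
  pres_brDl pres_brDr pres_brZl pres_brZr pres_brxx pres_jacobi.

Lemma pres_piB s t : pres_pi (TBr s t) = ⟦pres_pi s, pres_pi t⟧.
Proof. by rewrite -pres_brE. Qed.

Definition pres_gen (x : X) : pres := pres_pi (TGen x).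

Section Lift.
Variables (T : lieAlgType F) (f : X -> T).

Fixpoint lie_eval (t : lie_term) : T :=
  match t with
  | TGen x => f x
  | TZero => 0
  | TAdd s t => lie_eval s + lie_eval t
  | TScale a t => a *: lie_eval t
  | TBr s t => ⟦lie_eval s, lie_eval t⟧
  end.

(* Defined for every f, but only meaningful when f satisfies the relations R:
   it is then the unique homomorphism extending f. *)
Definition pres_lift (q : pres) : T := lie_eval (pres_repr q).

Hypothesis fR : forall s t, R s t -> lie_eval s = lie_eval t.

Lemma lie_eval_cong s t : lie_cong s t -> lie_eval s = lie_eval t.
Proof.
elim=> {s t} //=.
- by move=> s t u _ -> _ ->.
- by move=> s s' t t' _ -> _ ->.
- by move=> a t t' _ ->.
- by move=> s s' t t' _ -> _ ->.
- by move=> s t u; rewrite addrA.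
- by move=> s t; rewrite addrC.
- by move=> t; rewrite add0r.
- by move=> t; rewrite scaleN1r addNr.
- by move=> a b t; rewrite scalerA.
- by move=> t; rewrite scale1r.
- by move=> a s t; rewrite scalerDr.
- by move=> a b t; rewrite scalerDl.
- by move=> s t u; rewrite liebDl.
- by move=> s t u; rewrite liebDr.
- by move=> a s t; rewrite liebZl.
- by move=> a s t; rewrite liebZr.
- by move=> t; rewrite liebxx.
- by move=> s t u; rewrite lieb_jacobi.
Qed.

Lemma pres_lift_pi t : pres_lift (pres_pi t) = lie_eval t.
Proof. by apply: lie_eval_cong; apply: repr_presP. Qed.

Lemma pres_lift_gen x : pres_lift (pres_gen x) = f x.
Proof. by rewrite pres_lift_pi. Qed.

Lemma pres_lift_linear : linear pres_lift.
Proof.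
move=> a; elim/presW=> s; elim/presW=> t.
by rewrite -pres_piZ -pres_piD !pres_lift_pi.
Qed.

Lemma pres_lift_lieb p q : pres_lift ⟦p, q⟧ = ⟦pres_lift p, pres_lift q⟧.
Proof.
elim/presW: p => s; elim/presW: q => t.
by rewrite -pres_piB !pres_lift_pi.
Qed.

End Lift.
End Presentation.

Arguments TZero {F X}.

Section Ideals.
Variables (F : fieldType) (L : finLieAlgType F).

Definition is_lie_ideal (I : {vspace L}) :=
  forall x y, x \in I -> ⟦x, y⟧ \in I.

Record lie_ideal := LieIdeal {
  ideal_vspace :> {vspace L};
  ideal_vspaceP : is_lie_ideal ideal_vspace }.

Lemma ideal_lieb (I : lie_ideal) x y :
  x \in (I : {vspace L}) -> ⟦x, y⟧ \in (I : {vspace L}).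
Proof. exact: ideal_vspaceP. Qed.

Lemma ideal_liebl (I : lie_ideal) x y :
  y \in (I : {vspace L}) -> ⟦x, y⟧ \in (I : {vspace L}).
Proof. by move=> Iy; rewrite liebC rpredN ideal_lieb. Qed.

Definition ideal_br (I : lie_ideal) (m : subvs_of I) (y : L) : subvs_of I :=
  Subvs (ideal_lieb y (subvsP m)).

Definition ideal_brl (I : lie_ideal) (y : L) (m : subvs_of I) : subvs_of I :=
  Subvs (ideal_liebl y (subvsP m)).

Lemma full_is_ideal : is_lie_ideal fullv.
Proof. by move=> x y _; apply: memvf. Qed.

Definition full_ideal := LieIdeal full_is_ideal.

Inductive in_gen_ideal (S : L -> Prop) : L -> Prop :=
| Gen_in x : S x -> in_gen_ideal S x
| Gen_0 : in_gen_ideal S 0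
| Gen_add x y : in_gen_ideal S x -> in_gen_ideal S y -> in_gen_ideal S (x + y)
| Gen_scale a x : in_gen_ideal S x -> in_gen_ideal S (a *: x)
| Gen_lieb x y : in_gen_ideal S x -> in_gen_ideal S ⟦x, y⟧.

Definition gen_ideal_sig (S : L -> Prop) :=
  vspace_of_pred (Gen_0 S) (@Gen_add S) (@Gen_scale S).

Definition gen_ideal_vspace S : {vspace L} := sval (gen_ideal_sig S).

Lemma gen_idealP S x : x \in gen_ideal_vspace S <-> in_gen_ideal S x.
Proof. exact: (svalP (gen_ideal_sig S)). Qed.

Lemma gen_ideal_is_ideal S : is_lie_ideal (gen_ideal_vspace S).
Proof. by move=> x y /gen_idealP Sx; apply/gen_idealP/Gen_lieb. Qed.

Definition gen_ideal S := LieIdeal (@gen_ideal_is_ideal S).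

(* spanned by brackets of basis vectors; mem_lie_prod and lie_prod_sub show that
   this is the span of all the brackets [u, v] *)
Definition lie_prod (U V : {vspace L}) : {vspace L} :=
  <<[seq ⟦u, v⟧ | u <- vbasis U, v <- vbasis V]>>%VS.

Lemma mem_lie_prod (U V : {vspace L}) u v :
  u \in U -> v \in V -> ⟦u, v⟧ \in lie_prod U V.
Proof.
move=> Uu Vv; rewrite (coord_vbasis Uu) (coord_vbasis Vv) lieb_suml.
apply: rpred_sum => i _; rewrite lieb_sumr; apply: rpred_sum => j _.
rewrite liebZl liebZr; do 2!apply: rpredZ; apply: memv_span.
by apply: allpairs_f; apply: mem_nth; rewrite size_tuple.
Qed.

Lemma lie_prod_sub (U V W : {vspace L}) :
  (forall u v, u \in U -> v \in V -> ⟦u, v⟧ \in W) -> (lie_prod U V <= W)%VS.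
Proof.
move=> UVW; apply/span_subvP => _ /allpairsP[[u v] /= [Uu Vv ->]].
by apply: UVW; apply: vbasis_mem.
Qed.

Lemma lie_prod_is_ideal (I : lie_ideal) : is_lie_ideal (lie_prod I fullv).
Proof.
move=> x y IIx; apply: mem_lie_prod (memvf y).
have IIsub : (lie_prod I fullv <= I)%VS.
  by apply: lie_prod_sub => u v Iu _; apply: ideal_lieb.
exact: subvP IIsub _ IIx.
Qed.

Fixpoint lcs_rec (n : nat) : lie_ideal :=
  if n is n'.+1 then LieIdeal (@lie_prod_is_ideal (lcs_rec n'))
  else full_ideal.

(* numbered from 1: L^1 = L, L^{i+1} = [L^i, L]; the index 0 is a junk value *)
Definition lcs (i : nat) : lie_ideal := lcs_rec i.-1.

Lemma lcsS i : (0 < i)%N -> (lcs i.+1 : {vspace L}) = lie_prod (lcs i) fullv.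
Proof. by case: i. Qed.

Lemma lcs_sub i : (lcs i <= lcs i.-1)%VS.
Proof.
case: i => [|[|i]]; [exact: subvf|exact: subvf|rewrite lcsS //].
by apply: lie_prod_sub => u v Iu _; apply: ideal_lieb.
Qed.

Definition nilpotent_of_class (c : nat) : Prop :=
  (lcs c.+1 : {vspace L}) = 0%VS
  /\ forall j, (j < c)%N -> (lcs j.+1 : {vspace L}) <> 0%VS.

End Ideals.

Arguments full_ideal {F} L.
Arguments lcs {F} L i.
Arguments nilpotent_of_class {F} L c.

Section VectorQuotient.
Variables (F : fieldType) (V : vectType F) (U : {vspace V}).

Definition vquot_rel (x y : V) := x - y \in U.

Lemma vquot_refl : reflexive vquot_rel.
Proof. by move=> x; rewrite /vquot_rel subrr mem0v. Qed.

Lemma vquot_sym : symmetric vquot_rel.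
Proof. by move=> x y; rewrite /vquot_rel -opprB rpredN. Qed.

Lemma vquot_trans : transitive vquot_rel.
Proof. by move=> y x z xy yz; rewrite /vquot_rel -(subrKA y) rpredD. Qed.

Canonical vquot_equiv := EquivRel vquot_rel vquot_refl vquot_sym vquot_trans.

Definition vquot := {eq_quot vquot_rel}.

HB.instance Definition _ := Choice.on vquot.

Definition vquot_pi (x : V) : vquot := \pi_{eq_quot vquot_rel} x.
Definition vquot_repr (q : vquot) : V := repr (q : {eq_quot vquot_rel}).

Lemma vquot_eqP x y : vquot_pi x = vquot_pi y <-> x - y \in U.
Proof. by split=> [/eqmodP|xy]; last apply/eqmodP. Qed.

Lemma vquot_reprK : cancel vquot_repr vquot_pi.
Proof. by move=> q; exact: reprK. Qed.

Lemma repr_vquotP x : vquot_repr (vquot_pi x) - x \in U.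
Proof. by apply/vquot_eqP; rewrite vquot_reprK. Qed.

Lemma vquotW (P : vquot -> Prop) : (forall x, P (vquot_pi x)) -> forall q, P q.
Proof. by move=> Px q; rewrite -(vquot_reprK q). Qed.

Definition vquot_add p q := vquot_pi (vquot_repr p + vquot_repr q).
Definition vquot_opp p := vquot_pi (- vquot_repr p).
Definition vquot_scale a p := vquot_pi (a *: vquot_repr p).

Lemma vquot_addE x y : vquot_add (vquot_pi x) (vquot_pi y) = vquot_pi (x + y).
Proof. by apply/vquot_eqP; rewrite opprD addrACA rpredD ?repr_vquotP. Qed.

Lemma vquot_oppE x : vquot_opp (vquot_pi x) = vquot_pi (- x).
Proof. by apply/vquot_eqP; rewrite -opprD rpredN repr_vquotP. Qed.

Lemma vquot_scaleE a x : vquot_scale a (vquot_pi x) = vquot_pi (a *: x).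
Proof. by apply/vquot_eqP; rewrite -scalerBr rpredZ ?repr_vquotP. Qed.

Lemma vquot_addA : associative vquot_add.
Proof.
elim/vquotW=> x; elim/vquotW=> y; elim/vquotW=> z.
by rewrite !vquot_addE addrA.
Qed.

Lemma vquot_addC : commutative vquot_add.
Proof. by elim/vquotW=> x; elim/vquotW=> y; rewrite !vquot_addE addrC. Qed.

Lemma vquot_add0 : left_id (vquot_pi 0) vquot_add.
Proof. by elim/vquotW=> x; rewrite vquot_addE add0r. Qed.

Lemma vquot_addN : left_inverse (vquot_pi 0) vquot_opp vquot_add.
Proof. by elim/vquotW=> x; rewrite vquot_oppE vquot_addE addNr. Qed.

HB.instance Definition _ :=
  GRing.isZmodule.Build vquot vquot_addA vquot_addC vquot_add0 vquot_addN.

Lemma vquot_scaleA a b p :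
  vquot_scale a (vquot_scale b p) = vquot_scale (a * b) p.
Proof. by elim/vquotW: p => x; rewrite !vquot_scaleE scalerA. Qed.

Lemma vquot_scale1 : left_id 1 vquot_scale.
Proof. by elim/vquotW=> x; rewrite vquot_scaleE scale1r. Qed.

Lemma vquot_scaleDr : right_distributive vquot_scale +%R.
Proof.
move=> a; elim/vquotW=> x; elim/vquotW=> y.
have -> : vquot_pi x + vquot_pi y = vquot_pi (x + y) by exact: vquot_addE.
by rewrite !vquot_scaleE [RHS]vquot_addE scalerDr.
Qed.

Lemma vquot_scaleDl p : {morph vquot_scale^~ p : a b / a + b}.
Proof.
move=> a b; elim/vquotW: p => x.
by rewrite !vquot_scaleE [RHS]vquot_addE scalerDl.
Qed.

HB.instance Definition _ := GRing.Zmodule_isLmodule.Build F vquot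
  vquot_scaleA vquot_scale1 vquot_scaleDr vquot_scaleDl.

Lemma vquot_pi_linear : linear vquot_pi.
Proof. by move=> a x y; rewrite -vquot_addE -vquot_scaleE. Qed.

HB.instance Definition _ :=
  GRing.isLinear.Build F V vquot _ vquot_pi vquot_pi_linear.

Lemma vquot_pi_surj q : exists x, vquot_pi x = q.
Proof. by exists (vquot_repr q); apply: vquot_reprK. Qed.

HB.instance Definition _ :=
  Lmodule_hasFinDim.Build F vquot (projT2 (findim_surj vquot_pi_surj)).

Lemma vquot_pi_eq0 x : (vquot_pi x == 0) = (x \in U).
Proof.
apply/eqP/idP => [x0|Ux]; first by have /vquot_eqP := x0; rewrite subr0.
by apply/vquot_eqP; rewrite subr0.
Qed.

End VectorQuotient.

Section LieQuotient.
Variables (F : fieldType) (L : finLieAlgType F) (I : lie_ideal L).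

Definition lquot := vquot I.

HB.instance Definition _ := Vector.on lquot.

Definition lquot_pi : L -> lquot := @vquot_pi F L I.
Definition lquot_repr : lquot -> L := @vquot_repr F L I.

HB.instance Definition _ := GRing.isLinear.Build F L lquot _ lquot_pi
  (@vquot_pi_linear F L I).

Lemma lquot_eqP x y : lquot_pi x = lquot_pi y <-> x - y \in (I : {vspace L}).
Proof. exact: vquot_eqP. Qed.

Lemma lquot_reprK : cancel lquot_repr lquot_pi.
Proof. exact: vquot_reprK. Qed.

Lemma repr_lquotP x : lquot_repr (lquot_pi x) - x \in (I : {vspace L}).
Proof. exact: repr_vquotP. Qed.

Lemma lquotW (P : lquot -> Prop) : (forall x, P (lquot_pi x)) -> forall q, P q.
Proof. exact: vquotW. Qed.

Lemma lquot_piD x y : lquot_pi (x + y) = lquot_pi x + lquot_pi y.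
Proof. exact: (linearD lquot_pi). Qed.

Lemma lquot_piN x : lquot_pi (- x) = - lquot_pi x.
Proof. exact: (linearN lquot_pi). Qed.

Lemma lquot_piZ a x : lquot_pi (a *: x) = a *: lquot_pi x.
Proof. by rewrite linearZ. Qed.

Definition lquot_br (p q : lquot) : lquot :=
  lquot_pi ⟦lquot_repr p, lquot_repr q⟧.

Lemma lquot_brE x y : lquot_br (lquot_pi x) (lquot_pi y) = lquot_pi ⟦x, y⟧.
Proof.
apply/lquot_eqP; set x' := lquot_repr _; set y' := lquot_repr _.
have -> : ⟦x', y'⟧ - ⟦x, y⟧ = ⟦x' - x, y'⟧ + ⟦x, y' - y⟧.
  by rewrite liebBl liebBr addrA subrK.
by apply: rpredD; [apply: ideal_lieb|apply: ideal_liebl]; apply: repr_lquotP.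
Qed.

Lemma lquot_brDl p q r : lquot_br (p + q) r = lquot_br p r + lquot_br q r.
Proof.
elim/lquotW: p => x; elim/lquotW: q => y; elim/lquotW: r => z.
by rewrite -lquot_piD !lquot_brE liebDl lquot_piD.
Qed.

Lemma lquot_brDr p q r : lquot_br p (q + r) = lquot_br p q + lquot_br p r.
Proof.
elim/lquotW: p => x; elim/lquotW: q => y; elim/lquotW: r => z.
by rewrite -lquot_piD !lquot_brE liebDr lquot_piD.
Qed.

Lemma lquot_brZl a p q : lquot_br (a *: p) q = a *: lquot_br p q.
Proof.
elim/lquotW: p => x; elim/lquotW: q => y.
by rewrite -lquot_piZ !lquot_brE liebZl lquot_piZ.
Qed.

Lemma lquot_brZr a p q : lquot_br p (a *: q) = a *: lquot_br p q.
Proof.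
elim/lquotW: p => x; elim/lquotW: q => y.
by rewrite -lquot_piZ !lquot_brE liebZr lquot_piZ.
Qed.

Lemma lquot_brxx p : lquot_br p p = 0.
Proof. by elim/lquotW: p => x; rewrite lquot_brE liebxx linear0. Qed.

Lemma lquot_jacobi p q r :
  lquot_br p (lquot_br q r) + lquot_br q (lquot_br r p)
    + lquot_br r (lquot_br p q) = 0.
Proof.
elim/lquotW: p => x; elim/lquotW: q => y; elim/lquotW: r => z.
by rewrite !lquot_brE -!lquot_piD lieb_jacobi linear0.
Qed.

HB.instance Definition _ := Lmodule_isLie.Build F lquot
  lquot_brDl lquot_brDr lquot_brZl lquot_brZr lquot_brxx lquot_jacobi.

Lemma lquot_pi_lieb x y : lquot_pi ⟦x, y⟧ = ⟦lquot_pi x, lquot_pi y⟧.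
Proof. by rewrite -lquot_brE. Qed.

End LieQuotient.

Section LieTensor.
Variables (F : fieldType) (L : finLieAlgType F) (M N : lie_ideal L).

Local Notation term := (lie_term F (subvs_of M * subvs_of N)).
Local Notation "m ⊠ n" := (TGen F (m, n)) (at level 40).

Inductive tensor_rel : term -> term -> Prop :=
| Tensor_linl a m m' n :
    tensor_rel ((a *: m + m') ⊠ n) (TAdd (TScale a (m ⊠ n)) (m' ⊠ n))
| Tensor_linr a m n n' :
    tensor_rel (m ⊠ (a *: n + n')) (TAdd (TScale a (m ⊠ n)) (m ⊠ n'))
(* [m, m'] ⊗ n = m ⊗ [m', n] - m' ⊗ [m, n] *)
| Tensor_brl m m' n :
    tensor_rel (ideal_br m (vsval m') ⊠ n)
      (TAdd (m ⊠ ideal_brl (vsval m') n) (TOpp (m' ⊠ ideal_brl (vsval m) n)))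
(* m ⊗ [n, n'] = [n', m] ⊗ n - [n, m] ⊗ n' *)
| Tensor_brr m n n' :
    tensor_rel (m ⊠ ideal_br n (vsval n'))
      (TAdd (ideal_brl (vsval n') m ⊠ n) (TOpp (ideal_brl (vsval n) m ⊠ n')))
(* [m ⊗ n, m' ⊗ n'] = - [n, m] ⊗ [m', n'] *)
| Tensor_br m n m' n' :
    tensor_rel (TBr (m ⊠ n) (m' ⊠ n'))
      (TOpp (ideal_brl (vsval n) m ⊠ ideal_brl (vsval m') n')).

Definition lie_tensor := pres tensor_rel.

HB.instance Definition _ := LieAlg.on lie_tensor.

Definition tensor (m : subvs_of M) (n : subvs_of N) : lie_tensor :=
  pres_gen tensor_rel (m, n).

Lemma tensor_linl a m m' n :
  tensor (a *: m + m') n = a *: tensor m n + tensor m' n.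
Proof.
rewrite /tensor /pres_gen -pres_piZ -pres_piD.
exact/pres_eqP/Cong_rel/Tensor_linl.
Qed.

Lemma tensor_linr a m n n' :
  tensor m (a *: n + n') = a *: tensor m n + tensor m n'.
Proof.
rewrite /tensor /pres_gen -pres_piZ -pres_piD.
exact/pres_eqP/Cong_rel/Tensor_linr.
Qed.

Lemma tensor_brl m m' n :
  tensor (ideal_br m (vsval m')) n
  = tensor m (ideal_brl (vsval m') n) - tensor m' (ideal_brl (vsval m) n).
Proof.
rewrite /tensor /pres_gen -pres_piN -pres_piD.
exact/pres_eqP/Cong_rel/Tensor_brl.
Qed.

Lemma tensor_brr m n n' :
  tensor m (ideal_br n (vsval n'))
  = tensor (ideal_brl (vsval n') m) n - tensor (ideal_brl (vsval n) m) n'.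
Proof.
rewrite /tensor /pres_gen -pres_piN -pres_piD.
exact/pres_eqP/Cong_rel/Tensor_brr.
Qed.

Lemma tensor_lieb m n m' n' :
  ⟦tensor m n, tensor m' n'⟧
  = - tensor (ideal_brl (vsval n) m) (ideal_brl (vsval m') n').
Proof.
rewrite /tensor /pres_gen -pres_piN -pres_piB.
exact/pres_eqP/Cong_rel/Tensor_br.
Qed.

Lemma tensor_is_linearl n : linear (tensor^~ n).
Proof. by move=> a m m'; apply: tensor_linl. Qed.

Lemma tensor_is_linearr m : linear (tensor m).
Proof. by move=> a n n'; apply: tensor_linr. Qed.

HB.instance Definition _ m :=
  GRing.isLinear.Build F _ _ _ (tensor m) (tensor_is_linearr m).

(* By the last relation the span of the m ⊗ n is closed under brackets, so that
   the m ⊗ n for m, n in bases of M and N span the tensor product. *)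
Definition tensor_span
    (A : 'M[F]_(\dim {:subvs_of M}, \dim {:subvs_of N})) : lie_tensor :=
  \sum_i \sum_j A i j *:
    tensor (vbasis {:subvs_of M})`_i (vbasis {:subvs_of N})`_j.

Lemma tensor_span_linear : linear tensor_span.
Proof.
move=> a A B; rewrite /tensor_span scaler_sumr -big_split; apply: eq_bigr => i _.
rewrite scaler_sumr -big_split; apply: eq_bigr => j _.
by rewrite !mxE scalerDl scalerA.
Qed.

HB.instance Definition _ := GRing.isLinear.Build F _ _ _ tensor_span
  tensor_span_linear.

Lemma tensor_span_surj q : exists A, tensor_span A = q.
Proof.
have Sgen m n : exists A, tensor_span A = tensor m n.
  exists (\matrix_(i, j) (coord (vbasis {:subvs_of M}) i m *
                          coord (vbasis {:subvs_of N}) j n)).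
  pose tl u : {linear subvs_of M -> lie_tensor} :=
    HB.pack (tensor^~ u) (GRing.isLinear.Build _ _ _ _ _ (tensor_is_linearl u)).
  have tlE u u' : tensor u u' = tl u' u by [].
  rewrite [in RHS](coord_vbasis (memvf m)) [in RHS](coord_vbasis (memvf n)).
  rewrite tlE linear_sum; apply: eq_bigr => i _; rewrite linearZ /=.
  rewrite linear_sum scaler_sumr; apply: eq_bigr => j _.
  by rewrite linearZ /= mxE scalerA.
have Ssum (I : finType) (f : I -> lie_tensor) :
    (forall i, exists A, tensor_span A = f i) ->
  exists A, tensor_span A = \sum_i f i.
  move=> Sf; elim/big_ind: _ => [|_ _ [A <-] [B <-]|i _]; last exact: Sf.
    by exists 0; rewrite linear0.
  by exists (A + B); rewrite linearD.
have SZ a p : (exists A, tensor_span A = p) ->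
    exists A, tensor_span A = a *: p.
  by case=> A <-; exists (a *: A); rewrite linearZ.
elim/presW: q => t; elim: t => [[m n]||s [A As] t [B Bt]|a t At|s [A As] t [B Bt]].
- exact: Sgen.
- by exists 0; rewrite linear0.
- by exists (A + B); rewrite pres_piD -As -Bt (linearD tensor_span).
- by rewrite pres_piZ; apply: (SZ).
- rewrite pres_piB -As -Bt {2}/tensor_span lieb_sumr; apply: (Ssum) => i.
  rewrite lieb_sumr; apply: (Ssum) => j; rewrite liebZr; apply: (SZ).
  rewrite /tensor_span lieb_suml; apply: (Ssum) => k.
  rewrite lieb_suml; apply: (Ssum) => l; rewrite liebZl; apply: (SZ).
  by rewrite tensor_lieb -scaleN1r; apply: (SZ).
Qed.

HB.instance Definition _ :=
  Lmodule_hasFinDim.Build F lie_tensor (projT2 (findim_surj tensor_span_surj)).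

Definition diag_tensor (t : lie_tensor) : Prop :=
  exists (m : subvs_of M) (n : subvs_of N), vsval m = vsval n /\ t = tensor m n.

Definition wedge := lquot (gen_ideal diag_tensor).

HB.instance Definition _ := FinLieAlg.on wedge.

Definition wedge_gen (m : subvs_of M) (n : subvs_of N) : wedge :=
  lquot_pi (gen_ideal diag_tensor) (tensor m n).

Lemma wedge_linl a m m' n :
  wedge_gen (a *: m + m') n = a *: wedge_gen m n + wedge_gen m' n.
Proof. by rewrite /wedge_gen tensor_linl lquot_piD lquot_piZ. Qed.

Lemma wedge_linr a m n n' :
  wedge_gen m (a *: n + n') = a *: wedge_gen m n + wedge_gen m n'.
Proof. by rewrite /wedge_gen tensor_linr lquot_piD lquot_piZ. Qed.

Lemma wedge_brl m m' n :
  wedge_gen (ideal_br m (vsval m')) n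
  = wedge_gen m (ideal_brl (vsval m') n) - wedge_gen m' (ideal_brl (vsval m) n).
Proof. by rewrite /wedge_gen tensor_brl lquot_piD lquot_piN. Qed.

Lemma wedge_brr m n n' :
  wedge_gen m (ideal_br n (vsval n'))
  = wedge_gen (ideal_brl (vsval n') m) n - wedge_gen (ideal_brl (vsval n) m) n'.
Proof. by rewrite /wedge_gen tensor_brr lquot_piD lquot_piN. Qed.

Lemma wedge_lieb m n m' n' :
  ⟦wedge_gen m n, wedge_gen m' n'⟧
  = - wedge_gen (ideal_brl (vsval n) m) (ideal_brl (vsval m') n').
Proof. by rewrite /wedge_gen -lquot_piN -tensor_lieb lquot_pi_lieb. Qed.

Lemma wedge_diag (m : subvs_of M) (n : subvs_of N) :
  vsval m = vsval n -> wedge_gen m n = 0.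
Proof.
move=> mn; apply/eqP; rewrite vquot_pi_eq0; apply/gen_idealP/Gen_in.
by exists m, n.
Qed.

End LieTensor.

Notation "m ∧ n" := (wedge_gen m n) (at level 40) : ring_scope.

Section WedgeInclusion.
Variables (F : fieldType) (L : finLieAlgType F) (M M' N : lie_ideal L).
Hypothesis sMM' : (M <= M')%VS.

Definition ideal_incl (m : subvs_of M) : subvs_of M' :=
  Subvs (subvP sMM' _ (subvsP m)).

Definition tensor_incl : lie_tensor M N -> wedge M' N :=
  pres_lift (fun u => wedge_gen (ideal_incl u.1) (u.2 : subvs_of N)).

Definition wedge_incl_fun (w : wedge M N) : wedge M' N :=
  tensor_incl (lquot_repr w).

Definition wedge_incl : 'Hom(wedge M N, wedge M' N) := linfun wedge_incl_fun.

Let incl_rel s t : tensor_rel s t ->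
  lie_eval (fun u => wedge_gen (ideal_incl u.1) (u.2 : subvs_of N)) s
  = lie_eval (fun u => wedge_gen (ideal_incl u.1) (u.2 : subvs_of N)) t.
Proof.
case=> {s t} /= [a m m' n|a m n n'|m m' n|m n n'|m n m' n'];
  rewrite ?scaleN1r.
- by rewrite -wedge_linl; congr wedge_gen; apply/val_inj.
- by rewrite -wedge_linr.
- rewrite [ideal_incl _](_ : _ =
    ideal_br (ideal_incl m) (vsval (ideal_incl m'))); last exact/val_inj.
  by rewrite wedge_brl.
- by rewrite wedge_brr; congr (_ - _); congr wedge_gen; apply/val_inj.
- by rewrite wedge_lieb; congr (- _); congr wedge_gen; apply/val_inj.
Qed.

Lemma tensor_incl_linear : linear tensor_incl.
Proof. exact: pres_lift_linear incl_rel. Qed.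

HB.instance Definition _ :=
  GRing.isLinear.Build F _ _ _ tensor_incl tensor_incl_linear.

Lemma tensor_incl_lieb p q :
  tensor_incl ⟦p, q⟧ = ⟦tensor_incl p, tensor_incl q⟧.
Proof. exact: pres_lift_lieb incl_rel _ _. Qed.

Lemma tensor_incl_tensor m n : tensor_incl (tensor m n) = ideal_incl m ∧ n.
Proof. exact: pres_lift_gen incl_rel _. Qed.

Lemma tensor_incl_diag t :
  t \in (gen_ideal (@diag_tensor _ _ M N) : {vspace lie_tensor M N}) ->
  tensor_incl t = 0.
Proof.
move/gen_idealP; elim=> {t}.
- move=> _ [m [n [mn ->]]]; rewrite tensor_incl_tensor.
  exact: wedge_diag.
- exact: linear0.
- by move=> x y _ x0 _ y0; rewrite linearD /= x0 y0 addr0.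
- by move=> a x _ x0; rewrite linearZ /= x0 scaler0.
- by move=> x y _ x0; rewrite tensor_incl_lieb x0 lieb0l.
Qed.

Lemma wedge_incl_pi t : wedge_incl_fun (lquot_pi _ t) = tensor_incl t.
Proof.
apply/eqP; rewrite -subr_eq0 -linearB; apply/eqP/tensor_incl_diag.
exact: repr_lquotP.
Qed.

Lemma wedge_incl_fun_linear : linear wedge_incl_fun.
Proof.
move=> a; elim/lquotW=> x; elim/lquotW=> y.
by rewrite -linearZ -linearD !wedge_incl_pi linearP.
Qed.

Lemma wedge_inclE w : wedge_incl w = wedge_incl_fun w.
Proof.
pose f : {linear wedge M N -> wedge M' N} :=
  HB.pack wedge_incl_fun
    (GRing.isLinear.Build _ _ _ _ _ wedge_incl_fun_linear).
exact: (lfunE f).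
Qed.

Lemma wedge_incl_wedge m n : wedge_incl (m ∧ n) = ideal_incl m ∧ n.
Proof. by rewrite wedge_inclE wedge_incl_pi tensor_incl_tensor. Qed.

End WedgeInclusion.

Section VectorTensor.
Variable F : fieldType.

(* V ⊗ W in coordinates, v ⊗ w being the matrix (v_i w_j); its universal
   property is given by vtens_linearl, vtens_linearr, vtensor_lift_vtens and
   vtensor_ext. *)
Definition vtensor (V W : vectType F) : Type := 'M[F]_(\dim {:V}, \dim {:W}).

HB.instance Definition _ V W :=
  Vector.copy (vtensor V W) 'M[F]_(\dim {:V}, \dim {:W}).

Definition vtens (V W : vectType F) (v : V) (w : W) : vtensor V W :=
  \matrix_(i, j) (coord (vbasis {:V}) i v * coord (vbasis {:W}) j w).

Definition vtensor_lift (V W T : vectType F) (f : V -> W -> T)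
    (t : vtensor V W) : T :=
  \sum_i \sum_j (t : 'M_(_, _)) i j *:
    f (vbasis {:V})`_i (vbasis {:W})`_j.

Section Theory.
Variables V W : vectType F.

Lemma vtens_linearl (w : W) : linear (fun v : V => vtens v w).
Proof.
by move=> a v v'; apply/matrixP=> i j; rewrite !mxE linearP mulrDl mulrA.
Qed.

Lemma vtens_linearr (v : V) : linear (@vtens V W v).
Proof.
by move=> a w w'; apply/matrixP=> i j; rewrite !mxE linearP mulrDr mulrCA.
Qed.

HB.instance Definition _ v :=
  GRing.isLinear.Build F _ _ _ (@vtens V W v) (vtens_linearr v).

Lemma vtensor_lift_linear (T : vectType F) (f : V -> W -> T) :
  linear (vtensor_lift f).
Proof.
move=> a A B; rewrite /vtensor_lift scaler_sumr -big_split.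
apply: eq_bigr => i _; rewrite scaler_sumr -big_split; apply: eq_bigr => j _.
by rewrite !mxE scalerDl scalerA.
Qed.

HB.instance Definition _ (T : vectType F) (f : V -> W -> T) :=
  GRing.isLinear.Build F _ _ _ (vtensor_lift f) (vtensor_lift_linear f).

Lemma vtensor_lift_vtens (T : vectType F) (f : V -> W -> T) v w :
    (forall w, linear (f^~ w)) -> (forall v, linear (f v)) ->
  vtensor_lift f (vtens v w) = f v w.
Proof.
move=> fl fr.
pose gl u : {linear V -> T} :=
  HB.pack (f^~ u) (GRing.isLinear.Build _ _ _ _ _ (fl u)).
pose gr u : {linear W -> T} :=
  HB.pack (f u) (GRing.isLinear.Build _ _ _ _ _ (fr u)).
have glE u u' : f u u' = gl u' u by [].
have grE u u' : f u u' = gr u u' by [].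
rewrite [in RHS](coord_vbasis (memvf v)) [in RHS](coord_vbasis (memvf w)).
rewrite glE linear_sum; apply: eq_bigr => i _; rewrite linearZ /= grE.
rewrite linear_sum scaler_sumr; apply: eq_bigr => j _.
by rewrite linearZ /= scalerA mxE.
Qed.

Lemma vtensor_ext (T : vectType F) (f g : {linear vtensor V W -> T}) :
  (forall v w, f (vtens v w) = g (vtens v w)) -> f =1 g.
Proof.
move=> fg t; rewrite [t]matrix_sum_delta !linear_sum; apply: eq_bigr => i _.
rewrite !linear_sum; apply: eq_bigr => j _; rewrite !linearZ /=.
have -> : delta_mx i j
    = vtens (vbasis {:V})`_i (vbasis {:W})`_j.
  apply/matrixP=> k l; rewrite !mxE !coord_free ?(basis_free (vbasisP _)) //.
  by rewrite -natrM mulnb ![_ == k]eq_sym ![_ == l]eq_sym.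
by rewrite fg.
Qed.

End Theory.
End VectorTensor.

Notation "v ⊗ w" := (vtens v w) (at level 40) : ring_scope.

Section Maps.
Variables (F : fieldType) (L : finLieAlgType F).

(* L^{i+1} viewed inside L^i *)
Definition lcs_next (i : nat) : {vspace subvs_of (lcs L i)} :=
  (linfun vsval @^-1: lcs L i.+1)%VS.

Definition lcs_factor (i : nat) := vquot (lcs_next i).

HB.instance Definition _ i := Vector.on (lcs_factor i).

Definition lcs_factor_pi i : subvs_of (lcs L i) -> lcs_factor i :=
  @vquot_pi F _ (lcs_next i).

HB.instance Definition _ i := GRing.isLinear.Build F _ _ _ (@lcs_factor_pi i)
  (@vquot_pi_linear F _ (lcs_next i)).

Definition abelianization := lquot (lcs L 2).

HB.instance Definition _ := FinLieAlg.on abelianization.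

Definition ab_pi : L -> abelianization := lquot_pi (lcs L 2).
Definition ab_repr : abelianization -> L := @lquot_repr F L (lcs L 2).

HB.instance Definition _ := GRing.isLinear.Build F L abelianization _ ab_pi
  (@vquot_pi_linear F L (lcs L 2)).

Definition alpha (i : nat) :
    'Hom(wedge (lcs L i) (full_ideal L), wedge (lcs L i.-1) (full_ideal L)) :=
  wedge_incl (full_ideal L) (lcs_sub L i).

Lemma lieb_in_lcs2 (x y : L) : ⟦x, y⟧ \in (lcs L 2 : {vspace L}).
Proof. by apply: mem_lie_prod; apply: memvf. Qed.

Definition br23 (x y : L) : lcs_factor 2 :=
  @lcs_factor_pi 2 (Subvs (lieb_in_lcs2 x y)).

Definition gamma_gen (x y z : abelianization) :
    vtensor (lcs_factor 2) abelianization :=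
  br23 (ab_repr x) (ab_repr y) ⊗ z + br23 (ab_repr z) (ab_repr x) ⊗ y
  + br23 (ab_repr y) (ab_repr z) ⊗ x.

(* gamma_L, obtained from the universal property of the two tensor products;
   see gammaE for its values *)
Definition gamma_ :
    'Hom(vtensor (vtensor abelianization abelianization) abelianization,
         vtensor (lcs_factor 2) abelianization) :=
  linfun (vtensor_lift (fun t z =>
    vtensor_lift (fun x y => gamma_gen x y z) t)).

Lemma br23_linl y : linear (br23^~ y).
Proof.
move=> a x x'; rewrite /br23 -linearP; congr (lcs_factor_pi _).
by apply: val_inj; rewrite /= liebDl liebZl.
Qed.

Lemma br23_linr x : linear (br23 x).
Proof.
move=> a y y'; rewrite /br23 -linearP; congr (lcs_factor_pi _).
by apply: val_inj; rewrite /= liebDr liebZr.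
Qed.

Lemma br23_eq0 x y : ⟦x, y⟧ \in (lcs L 3 : {vspace L}) -> br23 x y = 0.
Proof.
move=> xy3; apply/eqP; rewrite vquot_pi_eq0.
by rewrite -memv_preim lfunE.
Qed.

Lemma br23_ab x y : br23 (ab_repr (ab_pi x)) (ab_repr (ab_pi y)) = br23 x y.
Proof.
set x' := ab_repr _; set y' := ab_repr _.
have lcs3 u v : u \in (lcs L 2 : {vspace L}) -> ⟦u, v⟧ \in (lcs L 3 : {vspace L}).
  by move=> u2; apply: mem_lie_prod (memvf v).
have xx' : x' - x \in (lcs L 2 : {vspace L}) by exact: repr_lquotP.
have yy' : y' - y \in (lcs L 2 : {vspace L}) by exact: repr_lquotP.
have -> : x' = 1 *: (x' - x) + x by rewrite scale1r subrK.
rewrite br23_linl br23_eq0 ?lcs3 // scaler0 add0r.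
have -> : y' = 1 *: (y' - y) + y by rewrite scale1r subrK.
by rewrite br23_linr br23_eq0 ?scaler0 ?add0r // liebC rpredN lcs3.
Qed.

Lemma gamma_genE x y z : gamma_gen (ab_pi x) (ab_pi y) (ab_pi z)
  = br23 x y ⊗ ab_pi z + br23 z x ⊗ ab_pi y + br23 y z ⊗ ab_pi x.
Proof. by rewrite /gamma_gen !br23_ab. Qed.

Lemma gamma_gen_lin1 y z : linear (fun x => gamma_gen x y z).
Proof.
move=> a; elim/lquotW: y => y; elim/lquotW: z => z.
elim/lquotW=> x; elim/lquotW=> x'.
rewrite -[lquot_pi _]/ab_pi -linearP !gamma_genE br23_linl br23_linr !linearP /=.
rewrite vtens_linearl [in X in _ + X + _]vtens_linearl !scalerDr.
by rewrite [X in X + _ = _]addrACA [LHS]addrACA.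
Qed.

Lemma gamma_gen_rot x y z : gamma_gen x y z = gamma_gen y z x.
Proof. by rewrite /gamma_gen -[RHS]addrA [RHS]addrC. Qed.

Lemma gamma_gen_lin2 x z : linear (fun y => gamma_gen x y z).
Proof. by move=> a y y'; rewrite !(gamma_gen_rot x); apply: gamma_gen_lin1. Qed.

Lemma gamma_gen_lin3 x y : linear (gamma_gen x y).
Proof. by move=> a z z'; rewrite -!(gamma_gen_rot _ x y); apply: gamma_gen_lin1. Qed.

Lemma gammaE x y z : gamma_ (ab_pi x ⊗ ab_pi y ⊗ ab_pi z)
  = br23 x y ⊗ ab_pi z + br23 z x ⊗ ab_pi y + br23 y z ⊗ ab_pi x.
Proof.
rewrite -gamma_genE lfunE /= vtensor_lift_vtens; first last.
- move=> t a u v; rewrite /vtensor_lift scaler_sumr -big_split.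
  apply: eq_bigr => i _; rewrite scaler_sumr -big_split.
  apply: eq_bigr => j _ /=.
  by rewrite gamma_gen_lin3 scalerDr !scalerA [a * _]mulrC.
- by move=> u; apply: vtensor_lift_linear.
rewrite vtensor_lift_vtens // => [u|u].
- exact: gamma_gen_lin1.
- exact: gamma_gen_lin2.
Qed.

Lemma alpha_wedge i (x : subvs_of (lcs L i)) z :
  alpha i (x ∧ z) = ideal_incl (lcs_sub L i) x ∧ z.
Proof. exact: wedge_incl_wedge. Qed.

End Maps.

Arguments lcs_factor {F} L i.
Arguments abelianization {F} L.
Arguments alpha {F} L i.
Arguments gamma_ {F} L.

(* Main.v *)
(* For i >= 2 the cokernel of alpha_{i+1} : L^{i+1} ∧ L -> L^i ∧ L is
   L^i/L^{i+1} ⊗ L/L^2, and the cokernel of alpha_2 is L/L^2 ∧ L/L^2: maps both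
   ways come from the universal properties, because x ∧ z lies in the image of
   alpha_{i+1} as soon as x is in L^{i+1} or z is in L^2.  Rank-nullity and
   L^{c+1} ∧ L = 0 then make the dimension count telescope to the equality.
   Jacobi-like triples in L^2 ∧ L die in L ∧ L, so Im gamma_L lies in the image
   of ker alpha_2 under L^2 ∧ L -> L^2/L^3 ⊗ L/L^2, and already dim ker alpha_2
   bounds dim Im gamma_L. *)
Require Import Defs.
From HB Require Import structures.
From mathcomp Require Import all_boot all_order all_algebra.

Set Implicit Arguments.
Unset Strict Implicit.
Unset Printing Implicit Defensive.

Import GRing.Theory.
Local Open Scope ring_scope.

(** * Linear maps out of the exterior product *)

Section AbelianLie.
Variables (F : fieldType) (V : lmodType F).

(* V carrying the zero bracket, so that linear maps into V can be obtained from
   the universal property of a presented Lie algebra. *)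
Definition abelian_lie : Type := V.

HB.instance Definition _ := GRing.Lmodule.on abelian_lie.

Let br (x y : abelian_lie) : abelian_lie := 0.

Fact abelian_lie_brD (x y z : abelian_lie) : 0 = 0 + 0 :> abelian_lie.
Proof. by rewrite addr0. Qed.

Fact abelian_lie_brZ (a : F) (x y : abelian_lie) : 0 = a *: 0 :> abelian_lie.
Proof. by rewrite scaler0. Qed.

Fact abelian_lie_jacobi (x y z : abelian_lie) : 0 + 0 + 0 = 0 :> abelian_lie.
Proof. by rewrite !addr0. Qed.

HB.instance Definition _ := @Lmodule_isLie.Build F abelian_lie br
  abelian_lie_brD abelian_lie_brD abelian_lie_brZ abelian_lie_brZ
  (fun _ => erefl) abelian_lie_jacobi.

Lemma abelian_lie_br (x y : abelian_lie) : ⟦x, y⟧ = 0.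
Proof. by []. Qed.

End AbelianLie.

Section WedgeMaps.
Variables (F : fieldType) (L : finLieAlgType F) (M N : lie_ideal L).

(** The bracket relation makes pure tensors span linearly, as [tensor_span_surj] records; so
    generators separate all linear maps, not only Lie homomorphisms. *)
Lemma wedge_ext (T : lmodType F) (f g : {linear wedge M N -> T}) :
  (forall m n, f (m ∧ n) = g (m ∧ n)) -> f =1 g.
Proof.
move=> fg; elim/lquotW=> t; have [A <-] := tensor_span_surj t.
rewrite /tensor_span /lquot_pi !linear_sum; apply: eq_bigr => i _ /=.
rewrite !linear_sum; apply: eq_bigr => j _ /=.
by rewrite !linearZ; congr (_ *: _); apply: fg.
Qed.

Lemma wedge_linearr (m : subvs_of M) : linear (@wedge_gen _ _ M N m).
Proof. by move=> a n n'; apply: wedge_linr. Qed.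

HB.instance Definition _ m := GRing.isLinear.Build F _ _ _
  (@wedge_gen _ _ M N m) (wedge_linearr m).

(** The hypotheses are the defining relations read in a target with zero bracket: [pres_lift] gives
    a homomorphism to [abelian_lie V], which then descends modulo the diagonal ideal. *)
Lemma wedge_lift (V : lmodType F) (f : subvs_of M -> subvs_of N -> V) :
    (forall n, linear (f^~ n)) -> (forall m, linear (f m)) ->
    (forall (m m' : subvs_of M) n, f (ideal_br m (vsval m')) n
       = f m (ideal_brl (vsval m') n) - f m' (ideal_brl (vsval m) n)) ->
    (forall m (n n' : subvs_of N), f m (ideal_br n (vsval n'))
       = f (ideal_brl (vsval n') m) n - f (ideal_brl (vsval n) m) n') ->
    (forall (m : subvs_of M) (n : subvs_of N) (m' : subvs_of M) (n' : subvs_of N),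
       f (ideal_brl (vsval n) m) (ideal_brl (vsval m') n') = 0) ->
    (forall (m : subvs_of M) (n : subvs_of N), vsval m = vsval n -> f m n = 0) ->
  {g : {linear wedge M N -> V} | forall m n, g (m ∧ n) = f m n}.
Proof.
move=> fl fr fbrl fbrr fbr fdiag.
pose h (u : subvs_of M * subvs_of N) : abelian_lie V := f u.1 u.2.
have hR s t : tensor_rel s t -> lie_eval h s = lie_eval h t.
  case=> {s t} /= [a m m' n|a m n n'|m m' n|m n n'|m n m' n'];
    rewrite ?scaleN1r.
  - exact: fl.
  - exact: fr.
  - exact: fbrl.
  - exact: fbrr.
  - by rewrite abelian_lie_br /h /= fbr oppr0.
have linh := pres_lift_linear hR.
pose H : {linear lie_tensor M N -> V} :=
  HB.pack (pres_lift h) (GRing.isLinear.Build _ _ V _ _ linh).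
have HE m n : H (tensor m n) = f m n by exact: pres_lift_gen hR _.
have Hdiag t : t \in (gen_ideal (@diag_tensor _ _ M N) : {vspace _}) -> H t = 0.
  move/gen_idealP; elim=> {t}.
  - by move=> _ [m [n [mn ->]]]; rewrite HE fdiag.
  - exact: linear0.
  - by move=> x y _ x0 _ y0; rewrite (linearD H) x0 y0 addr0.
  - by move=> a x _ x0; rewrite (linearZ_LR H) x0 scaler0.
  (* The image of a bracket is a bracket in [abelian_lie V], which is [0] by conversion. *)
  - by move=> x y _ _; exact: (pres_lift_lieb hR x y).
pose g (w : wedge M N) := H (lquot_repr w).
have gpi t : g (lquot_pi _ t) = H t.
  by apply/eqP; rewrite -subr_eq0 -linearB; apply/eqP/Hdiag/repr_lquotP.
have glin : linear g.
  move=> a; elim/lquotW=> x; elim/lquotW=> y.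
  by rewrite -lquot_piZ -lquot_piD !gpi linearP.
pose G : {linear wedge M N -> V} :=
  HB.pack g (GRing.isLinear.Build _ _ _ _ _ glin).
exists G => m n; exact: etrans (gpi _) (HE m n).
Qed.

Lemma wedge0l (n : subvs_of N) : (0 : subvs_of M) ∧ n = 0.
Proof.
have := wedge_linl (-1) (0 : subvs_of M) 0 n.
by rewrite scaler0 addr0 scaleN1r addNr.
Qed.

Lemma dim_wedge0l : (M : {vspace L}) = 0%VS -> \dim {: wedge M N} = 0%N.
Proof.
move=> M0; apply/eqP; rewrite dimv_eq0; apply/eqP/vspaceP=> w.
rewrite memvf memv0; apply/esym/eqP.
apply: (@wedge_ext _ idfun \0 _ w) => m n /=.
have m0 : vsval m = 0 by apply/eqP; rewrite -memv0 -M0 subvsP.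
by have -> : m = 0 by [apply: val_inj]; apply: wedge0l.
Qed.

End WedgeMaps.

(** * Vector-space tensor products and cokernels of linear maps *)

Lemma tens0l (F : fieldType) (V W : vectType F) (w : W) : (0 : V) ⊗ w = 0.
Proof. by apply/matrixP=> i j; rewrite !mxE linear0 mul0r. Qed.

(** The projection modulo [limg f] vanishes on pure tensors, hence everywhere. *)
Lemma vtensor_surj (F : fieldType) (V W T : vectType F)
    (f : 'Hom(T, vtensor V W)) :
  (forall v w, v ⊗ w \in limg f) -> limg f = fullv.
Proof.
move=> fvw; apply/vspaceP=> t; rewrite memvf -vquot_pi_eq0; apply/eqP.
by apply: (@vtensor_ext _ _ _ _ (vquot_pi (limg f)) \0) => v w; apply/eqP;
  rewrite vquot_pi_eq0.
Qed.

Section Cokernel.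
Variables (F : fieldType) (U V T : vectType F) (f : 'Hom(U, V)).
Variables (phi : {linear V -> T}) (psi : {linear T -> vquot (limg f)}).
Hypotheses (phi_f : forall u, phi (f u) = 0).
Hypothesis psiK : forall v, psi (phi v) = vquot_pi (limg f) v.

(** [psi] recovers the class of [v] modulo [limg f] from [phi v], so [phi] kills nothing outside
    that image. *)
Lemma lker_coker : lker (linfun phi) = limg f.
Proof.
apply/vspaceP=> v; rewrite memv_ker lfunE /=; apply/eqP/idP => [v0|].
  by rewrite -vquot_pi_eq0 -psiK v0 linear0.
by case/memv_imgP=> u _ ->; apply: phi_f.
Qed.

Lemma dim_coker : limg (linfun phi) = fullv ->
  (\dim {: V} = \dim (limg f) + \dim {: T})%N.
Proof. by move=> <-; rewrite -lker_coker -(limg_ker_dim (linfun phi)) capfv. Qed.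

End Cokernel.

(** * The cokernels of the maps [alpha] *)

Section Alpha.
Variables (F : fieldType) (L : finLieAlgType F).
Local Notation full := (full_ideal L).
Local Notation Lab := (abelianization L).

(** Factors of a wedge live in subspace types of ideals; this lets elements of [L] or of its
    abelianization enter there. *)
Definition in_full (K : finLieAlgType F) (x : K) : subvs_of (full_ideal K) :=
  Subvs (memvf x).

Lemma in_full_linear K : linear (@in_full K).
Proof. by move=> a x y; apply: val_inj. Qed.

HB.instance Definition _ K := GRing.isLinear.Build F _ _ _ (@in_full K)
  (@in_full_linear K).

Lemma vsval_in_full (K : finLieAlgType F) (x : subvs_of (full_ideal K)) :
  in_full (vsval x) = x.
Proof. exact: val_inj. Qed.

Lemma ab_pi_eq0 x : (ab_pi x == 0) = (x \in (lcs L 2 : {vspace L})).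
Proof. exact: vquot_pi_eq0. Qed.

Lemma ab_pi_lieb (x y : L) : ab_pi ⟦x, y⟧ = 0.
Proof. by apply/eqP; rewrite ab_pi_eq0 lieb_in_lcs2. Qed.

Lemma lcs_factor_pi_eq0 i (x : subvs_of (lcs L i)) :
  (lcs_factor_pi x == 0) = (vsval x \in (lcs L i.+1 : {vspace L})).
Proof. by rewrite vquot_pi_eq0 -memv_preim lfunE. Qed.

Lemma lcs_factor_pi_br i (x : subvs_of (lcs L i)) y :
  (0 < i)%N -> lcs_factor_pi (ideal_br x y) = 0.
Proof.
move=> i_gt0; apply/eqP; rewrite lcs_factor_pi_eq0 lcsS //.
by apply: mem_lie_prod (memvf y); apply: subvsP.
Qed.

Lemma lcs_factor_pi_brl i (x : subvs_of (lcs L i)) y :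
  (0 < i)%N -> lcs_factor_pi (ideal_brl y x) = 0.
Proof.
move=> i_gt0; have -> : ideal_brl y x = - ideal_br x y.
  by apply: val_inj; rewrite /= liebC.
by rewrite linearN /= lcs_factor_pi_br ?oppr0.
Qed.

Lemma lcs_sub_le i j : (i <= j)%N -> (lcs L j <= lcs L i)%VS.
Proof.
elim: j => [|j IH]; first by rewrite leqn0 => /eqP ->.
rewrite leq_eqVlt => /predU1P[-> //|/IH]; apply: subv_trans.
exact: (lcs_sub L j.+1).
Qed.

(* The map L^i ∧ L -> L^i/L^{i+1} ⊗ L/L^2 exists only from i = 2 on, as it must
   kill x ∧ x for x in L^i. *)
Lemma wedge_to_factor i : (1 < i)%N ->
  {phi : {linear wedge (lcs L i) full -> vtensor (lcs_factor L i) Lab}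
  | forall m n, phi (m ∧ n) = lcs_factor_pi m ⊗ ab_pi (vsval n)}.
Proof.
move=> i_gt1; have i_gt0 := ltnW i_gt1.
apply: wedge_lift => [n a m m'|m a n n'|m m' n|m n n'|m n m' n'|m n mn].
- by rewrite linearP vtens_linearl.
- by rewrite /= !linearP.
- by rewrite /= lcs_factor_pi_br // tens0l !ab_pi_lieb !linear0 addr0.
- by rewrite /= !lcs_factor_pi_brl // !tens0l ab_pi_lieb !linear0 addr0.
- by rewrite /= lcs_factor_pi_brl // tens0l.
- have /eqP -> : ab_pi (vsval n) == 0; last exact: linear0.
  by rewrite ab_pi_eq0 -mn; apply: (subvP (lcs_sub_le i_gt1)); apply: subvsP.
Qed.

Lemma alpha_img i (x : subvs_of (lcs L i)) z :
  vsval x \in (lcs L i.+1 : {vspace L}) -> x ∧ z \in limg (alpha L i.+1).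
Proof.
move=> x1; apply/memv_imgP; exists (Subvs x1 ∧ z); first exact: memvf.
by rewrite alpha_wedge; congr (_ ∧ _); apply: val_inj.
Qed.

(** For a bracket on the right, x ∧ [u, v] = [v, x] ∧ u - [u, x] ∧ v, and both terms come from
    L^{i+1} ∧ L. *)
Lemma alpha_img_lcs2 i (x : subvs_of (lcs L i)) z :
  (0 < i)%N -> vsval z \in (lcs L 2 : {vspace L}) ->
  x ∧ z \in limg (alpha L i.+1).
Proof.
move=> i_gt0 z2; rewrite -vquot_pi_eq0 -(vsval_in_full z).
pose f := linfun (vquot_pi (limg (alpha L i.+1)) \o wedge_gen x \o @in_full L).
have fE y : f y = vquot_pi (limg (alpha L i.+1)) (x ∧ in_full y).
  by rewrite lfunE.
(* Brackets suffice, since they span L^2 and the kernel of [f] is a subspace. *)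
rewrite -fE -memv_ker; apply: subvP (vsval z) z2; rewrite lcsS //.
apply: lie_prod_sub => u v _ _; rewrite memv_ker fE vquot_pi_eq0.
have -> : in_full ⟦u, v⟧ = ideal_br (in_full u) (vsval (in_full v)).
  exact: val_inj.
have brl y : vsval (ideal_brl y x) \in (lcs L i.+1 : {vspace L}).
  rewrite /= liebC rpredN lcsS //.
  by apply: mem_lie_prod (memvf y); apply: subvsP.
by rewrite wedge_brr; apply: rpredB; apply: alpha_img; apply: brl.
Qed.

(** This makes maps defined through chosen representatives independent of the choice: the difference
    splits as (x - x') ∧ z + x' ∧ (z - z'). *)
Lemma coker_alpha_eq i (x x' : subvs_of (lcs L i)) (z z' : subvs_of full) :
    (0 < i)%N -> vsval (x - x') \in (lcs L i.+1 : {vspace L}) ->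
    vsval (z - z') \in (lcs L 2 : {vspace L}) ->
  vquot_pi (limg (alpha L i.+1)) (x ∧ z)
  = vquot_pi (limg (alpha L i.+1)) (x' ∧ z').
Proof.
move=> i_gt0 xx' zz'; apply/vquot_eqP.
have -> : x ∧ z - x' ∧ z' = (x - x') ∧ z + x' ∧ (z - z').
  rewrite -[x in LHS](subrK x') -[x - x' in LHS]scale1r wedge_linl scale1r.
  by rewrite -addrA linearB.
by apply: rpredD; [apply: alpha_img | apply: alpha_img_lcs2].
Qed.

Lemma ab_reprK : cancel (@ab_repr F L) (@ab_pi F L).
Proof. exact: lquot_reprK. Qed.

Lemma ab_repr_eq (w : Lab) z : ab_pi z = w ->
  ab_repr w - z \in (lcs L 2 : {vspace L}).
Proof. by move=> <-; apply: repr_lquotP. Qed.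

(** Both classes are replaced by chosen representatives; [coker_alpha_eq] gives bilinearity and the
    stated values. *)
Lemma factor_to_coker i : (0 < i)%N ->
  {psi : {linear vtensor (lcs_factor L i) Lab -> vquot (limg (alpha L i.+1))}
  | forall m n, psi (lcs_factor_pi m ⊗ ab_pi (vsval n)) = vquot_pi _ (m ∧ n)}.
Proof.
move=> i_gt0.
pose g (p : lcs_factor L i) (w : Lab) : vquot (limg (alpha L i.+1)) :=
  vquot_pi _ ((vquot_repr p : subvs_of _) ∧ in_full (ab_repr w)).
have repr_factor (x : subvs_of (lcs L i)) p : lcs_factor_pi x = p ->
    vsval ((vquot_repr p : subvs_of _) - x) \in (lcs L i.+1 : {vspace L}).
  move=> <-; have := repr_vquotP (lcs_next L i) x.
  by rewrite -memv_preim lfunE.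
have gl w : linear (g^~ w).
  move=> a p p'; rewrite /g -linearP -wedge_linl; apply: coker_alpha_eq => //.
    by apply: repr_factor; rewrite linearP /= /lcs_factor_pi !vquot_reprK.
  by rewrite subrr mem0v.
have gr p : linear (g p).
  move=> a w w'; rewrite /g -linearP -wedge_linr; apply: coker_alpha_eq => //.
    by rewrite subrr mem0v.
  by apply: ab_repr_eq; rewrite linearP /= !ab_reprK.
exists (vtensor_lift g) => m n; rewrite /= vtensor_lift_vtens //.
by apply: coker_alpha_eq => //; [apply: repr_factor | apply: ab_repr_eq].
Qed.

Lemma dim_coker_alpha i : (1 < i)%N ->
  (\dim {: wedge (lcs L i) full} = \dim (limg (alpha L i.+1))
     + \dim {: vtensor (lcs_factor L i) Lab})%N.
Proof.
move=> i_gt1.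
have [phi phiE] := wedge_to_factor i_gt1.
have [psi psiE] := factor_to_coker (ltnW i_gt1).
apply: (@dim_coker _ _ _ _ _ phi psi) => [u|v|].
- pose phi' := phi \o alpha L i.+1.
  apply: (@wedge_ext _ _ _ _ _ phi' \0) => m n.
  rewrite /phi' /= alpha_wedge phiE.
  have /eqP -> : lcs_factor_pi (ideal_incl (lcs_sub L i.+1) m) == 0.
    by rewrite lcs_factor_pi_eq0 /= subvsP.
  exact: tens0l.
- pose psi' := psi \o phi.
  by apply: (@wedge_ext _ _ _ _ _ psi' (vquot_pi _)) => m n; rewrite /= phiE psiE.
- apply: vtensor_surj; elim/vquotW=> m; elim/lquotW=> n.
  apply/memv_imgP; exists (m ∧ in_full n); first exact: memvf.
  by rewrite lfunE /= phiE.
Qed.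

(** Functoriality of ∧ along L -> L/L^2; the bracket relations become 0 = 0 because [ab_pi] kills
    brackets. *)
Lemma wedge_to_ab :
  {phi : {linear wedge full full -> wedge (full_ideal Lab) (full_ideal Lab)}
  | forall m n, phi (m ∧ n) =
      in_full (ab_pi (vsval m)) ∧ in_full (ab_pi (vsval n))}.
Proof.
apply: wedge_lift => [n a m m'|m a n n'|m m' n|m n n'|m n m' n'|m n mn].
- by rewrite /= !linearP wedge_linl.
- by rewrite /= !linearP.
- by rewrite /= !ab_pi_lieb !linear0 wedge0l addr0.
- by rewrite /= !ab_pi_lieb !linear0 !wedge0l subrr.
- by rewrite /= !ab_pi_lieb !linear0.
- by rewrite wedge_diag //= mn.
Qed.

Lemma ab_to_coker :
  {psi : {linear wedge (full_ideal Lab) (full_ideal Lab) ->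
                 vquot (limg (alpha L 2))}
  | forall m n : subvs_of full,
      psi (in_full (ab_pi (vsval m)) ∧ in_full (ab_pi (vsval n)))
      = vquot_pi _ (m ∧ n)}.
Proof.
pose r (p : subvs_of (full_ideal Lab)) : subvs_of full :=
  in_full (ab_repr (vsval p)).
pose g p q : vquot (limg (alpha L 2)) := vquot_pi _ (r p ∧ r q).
have gE (m n : subvs_of full) p q :
    ab_pi (vsval m) = vsval p -> ab_pi (vsval n) = vsval q ->
  g p q = vquot_pi _ (m ∧ n).
  (* [lcs L 1] is [full_ideal L] by conversion, and for i = 1 both congruences are modulo L^2. *)
  by move=> mp nq; apply: (@coker_alpha_eq 1) => //; apply: ab_repr_eq.
have br0 (p q : Lab) : ⟦p, q⟧ = 0.
  by elim/lquotW: p => p; elim/lquotW: q => q; rewrite -lquot_pi_lieb; apply: ab_pi_lieb.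
have rK p : ab_pi (vsval (r p)) = vsval p by exact: ab_reprK.
have gl q : linear (g^~ q).
  move=> a p p'; rewrite (gE (a *: r p + r p') (r q)) ?rK //.
    by rewrite wedge_linl linearP.
  by rewrite /= linearP /= !ab_reprK.
have gr p : linear (g p).
  move=> a q q'; rewrite (gE (r p) (a *: r q + r q')) ?rK //.
    by rewrite wedge_linr linearP.
  by rewrite /= linearP /= !ab_reprK.
have g0l p q : vsval p = 0 -> g p q = 0.
  by move=> p0; rewrite (gE 0 (r q)) ?rK ?p0 ?linear0 // wedge0l linear0.
have g0r p q : vsval q = 0 -> g p q = 0.
  by move=> q0; rewrite (gE (r p) 0) ?rK ?q0 ?linear0.
(* Brackets in L/L^2 vanish by [br0], which settles the bracket relations; on the diagonal, equal
   classes have the same representative. *)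
have [p p' q|p q q'|p q p' q'|p q pq|psi psiE] := wedge_lift gl gr.
- by rewrite g0l ?g0r ?subrr //=.
- by rewrite g0r ?g0l ?subrr //=.
- by rewrite g0l //=.
- by rewrite /g /r pq wedge_diag ?linear0.
- by exists psi => m n; rewrite psiE; apply: gE.
Qed.

(** The case i = 1 stands apart: the relations x ∧ x = 0 with x outside L^2 persist in the cokernel,
    which is therefore an exterior and not a tensor product. *)
Lemma dim_coker_alpha2 :
  (\dim {: wedge full full} = \dim (limg (alpha L 2))
     + \dim {: wedge (full_ideal Lab) (full_ideal Lab)})%N.
Proof.
have [phi phiE] := wedge_to_ab; have [psi psiE] := ab_to_coker.
apply: (@dim_coker _ _ _ _ _ phi psi) => [u|v|].
- pose phi' := phi \o alpha L 2.
  apply: (@wedge_ext _ _ _ _ _ phi' \0) => m n.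
  rewrite /phi' /= alpha_wedge phiE.
  have /eqP -> : ab_pi (vsval (ideal_incl (lcs_sub L 2) m)) == 0.
    by rewrite ab_pi_eq0 /= subvsP.
  by rewrite linear0 wedge0l.
- pose psi' := psi \o phi.
  by apply: (@wedge_ext _ _ _ _ _ psi' (vquot_pi _)) => m n; rewrite /= phiE psiE.
- apply/vspaceP=> w; rewrite memvf -vquot_pi_eq0; apply/eqP.
  apply: (@wedge_ext _ _ _ _ _ (vquot_pi (limg (linfun phi))) \0) => m n.
  apply/eqP; rewrite vquot_pi_eq0 -(vsval_in_full m) -(vsval_in_full n).
  elim/lquotW: (vsval m) => x; elim/lquotW: (vsval n) => y.
  apply/memv_imgP; exists (in_full x ∧ in_full y); first exact: memvf.
  by rewrite lfunE /= phiE.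
Qed.

(** * The image of [gamma_] and the dimension count *)

Lemma dim_ker_alpha i : (\dim {: wedge (lcs L i) full}
  = \dim (lker (alpha L i)) + \dim (limg (alpha L i)))%N.
Proof. by have := limg_ker_dim (alpha L i) fullv; rewrite capfv => <-. Qed.

(* In L ∧ L the relation for [x, y] ∧ z and the antisymmetry of ∧ give
   [x, y] ∧ z + [z, x] ∧ y + [y, z] ∧ x = 0, so gamma_L takes its values in the
   image of the kernel of alpha_2. *)
Lemma dim_limg_gamma :
  (\dim (limg (gamma_ L)) <= \dim (lker (alpha L 2)))%N.
Proof.
have [phi phiE] := @wedge_to_factor 2 isT.
apply: (@leq_trans (\dim (linfun phi @: lker (alpha L 2)))); last first.
  by rewrite -[leqRHS](limg_ker_dim (linfun phi)) leq_addl.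
apply: dimvS; apply/subvP=> _ /memv_imgP[t _ ->].
set U := (_ @: _)%VS; rewrite -vquot_pi_eq0; apply/eqP.
pose f := vquot_pi U \o gamma_ L.
apply: (@vtensor_ext _ _ _ _ f \0) => t' w.
(* [lw] fixes the third factor, so that a second use of [vtensor_ext] reduces to triple pure
   tensors. *)
pose lw : {linear vtensor Lab Lab -> vtensor (vtensor Lab Lab) Lab} :=
  HB.pack (fun u => u ⊗ w) (GRing.isLinear.Build _ _ _ _ _ (vtens_linearl w)).
apply: (@vtensor_ext _ _ _ _ (f \o lw) \0) => p q /=.
elim/lquotW: p => x; elim/lquotW: q => y; elim/lquotW: w @lw => z _.
apply/eqP; rewrite vquot_pi_eq0 -/(ab_pi x) -/(ab_pi y) -/(ab_pi z) gammaE.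
pose b u v : subvs_of (lcs L 2) := Subvs (lieb_in_lcs2 u v).
apply/memv_imgP.
exists (b x y ∧ in_full z + b z x ∧ in_full y + b y z ∧ in_full x); last first.
  by rewrite lfunE /= !linearD /= !phiE.
have diag (u : subvs_of full) : u ∧ u = 0 by apply: wedge_diag.
have antisym (u v : subvs_of full) : u ∧ v = - (v ∧ u).
  apply/eqP; rewrite -addr_eq0; apply/eqP; have := diag (1 *: u + v).
  by rewrite wedge_linl !scale1r !linearD /= !diag add0r addr0.
rewrite memv_ker !linearD /= !alpha_wedge.
have bE u v : ideal_incl (lcs_sub L 2) (b u v) = in_full ⟦u, v⟧ by apply: val_inj.
rewrite !bE; apply/eqP.
have -> : in_full ⟦x, y⟧ = ideal_br (in_full x) (vsval (in_full y)).
  exact: val_inj.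
have brE u v : ideal_brl u (in_full v) = in_full ⟦u, v⟧ by apply: val_inj.
(* The first term expands to x ∧ [y, z] - y ∧ [x, z]; antisymmetry turns the other two into y ∧
   [x, z] and - x ∧ [y, z]. *)
rewrite wedge_brl !brE (antisym (in_full ⟦y, z⟧)) /=.
rewrite (liebC z x) linearN /= -[- in_full _]scaleN1r -[_ *: _]addr0 wedge_linl.
rewrite wedge0l addr0 scaleN1r (antisym (in_full ⟦x, z⟧)) opprK.
by rewrite subrK subrr.
Qed.

(** In the induction step, the kernel and image of alpha_{n+2} add up to dim (L^{n+2} ∧ L), which
    [dim_coker_alpha] splits into the next tensor term and the next remainder. *)
Lemma dim_alpha_telescope n :
  (\dim {: wedge full full} + \sum_(2 <= i < n.+2) \dim (lker (alpha L i))
   = \dim {: wedge (full_ideal Lab) (full_ideal Lab)}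
     + \sum_(2 <= i < n.+2) \dim {: vtensor (lcs_factor L i) Lab}
     + \dim (limg (alpha L n.+2)))%N.
Proof.
elim: n => [|n IH]; first by rewrite !big_geq // !addn0 dim_coker_alpha2 addnC.
rewrite !(@big_nat_recr _ _ _ n.+2) //= addnA IH -!addnA; do 2!congr addn.
by rewrite addnC -dim_ker_alpha dim_coker_alpha // addnC.
Qed.

(** This puts the term i = 2, which bounds dim Im gamma_L, into the sum. If c <= 1, then L^2 lies in
    L^{c+1} = 0. *)
Lemma nilpotent_class_gt1 c :
  nilpotent_of_class L c -> ~ lie_abelian L -> (1 < c)%N.
Proof.
case=> c0 _ Lnab; rewrite ltnNge; apply/negP=> c_le1; apply: Lnab => x y.
have := subvP (@lcs_sub_le c.+1 2 c_le1) _ (lieb_in_lcs2 x y).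
by rewrite c0 memv0 => /eqP.
Qed.

End Alpha.

Theorem theorem2p6 (F : fieldType) (L : finLieAlgType F) (c : nat)
    (L_class : nilpotent_of_class L c) (L_nonab : ~ lie_abelian L) :
  let Lab := abelianization L in
  let dimLL := \dim {: wedge (full_ideal L) (full_ideal L)} in
  let sum_ker := (\sum_(2 <= i < c.+1) \dim (lker (alpha L i)))%N in
  (dimLL + \dim (limg (gamma_ L)) <= dimLL + sum_ker)%N
  /\ (dimLL + sum_ker)%N
     = (\dim {: wedge (full_ideal Lab) (full_ideal Lab)}
        + \sum_(2 <= i < c.+1) \dim {: vtensor (lcs_factor L i) Lab})%N.
Proof.
move=> Lab dimLL sum_ker; have c_gt1 := nilpotent_class_gt1 L_class L_nonab.
split.
  rewrite leq_add2l /sum_ker big_ltn //.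
  by apply: leq_trans (dim_limg_gamma L) (leq_addr _ _).
(* The class is now [c.+1], so the sums match the telescope at n = c, and its remainder is the image
   of alpha_{c+2}, whose source is 0 by [c0]. *)
case: c c_gt1 L_class @sum_ker => [//|c] _ [c0 _] /=.
rewrite dim_alpha_telescope [\dim (limg _)](_ : _ = 0)%N ?addn0 //.
apply/eqP; rewrite -leqn0 -(dim_wedge0l (full_ideal L) c0).
by rewrite -(limg_ker_dim (alpha L c.+2) fullv) leq_addl.
Qed.
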